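(* Let $p\geq 5$ be any fixed prime integer, and let $\varphi_{p-1,c}$ be any polynomial map defined by $\varphi_{p-1,c}(z)=z^{p-1}+c$ for $c,z\in\mathbb{Z}$. Let $M_c(p)=\#\{z\in\mathbb{Z}/p\mathbb{Z} : \varphi_{p-1,c}(z)-z\equiv 0\pmod p\}$. Then $M_c(p)=1$ for every $c\equiv 1\pmod p$; $M_c(p)=2$ for every $c=pt$ with $t\in\mathbb{Z}$; and $M_c(p)=0$ for every $c\equiv -1\pmod p$. *)

(* Defs.v *)
From HB Require Import structures.
From mathcomp Require Import all_boot all_order all_algebra.

Set Implicit Arguments.
Unset Strict Implicit.
Unset Printing Implicit Defensive.

Import GRing.Theory.
Local Open Scope ring_scope.

Definition phi (d : nat) (c : int) : {poly int} := 'X^d + c%:P.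

(* The polynomial acts on Z/pZ through the reduction of its coefficients.
   'F_p is Z/pZ only when p is prime, so M is meaningful for prime p only. *)
Definition M (p : nat) (c : int) : nat :=
  #|[set z : 'F_p | (map_poly intr (phi (p - 1) c)).[z] - z == 0]|.

(* Main.v *)
Require Import Defs.
From mathcomp Require Import all_boot all_order all_algebra.
From mathcomp Require Import finfield.

(** By Fermat's little theorem [z ^ (p - 1)] is [1] for every nonzero residue
    [z], so on [Z/pZ] the polynomial map is constant, equal to [1 + c], away
    from [0], and sends [0] to [c].  Hence the only possible fixed points are
    [0], which is fixed exactly when [c = 0], and [1 + c], which is fixed
    exactly when it is nonzero.  Counting these two candidates ([M_count])
    gives [M p c] for every residue of [c]: it is [2] at [0], [0] at [-1], and
    [1] at every other residue, in particular at [1], which differs from [0]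
    and, since [p] is odd, from [-1]. *)

Import GRing.Theory.
Local Open Scope ring_scope.

Lemma Fp_fermat (p : nat) (z : 'F_p) :
  prime p -> z ^+ (p - 1) = (z != 0)%:R.
Proof.
move=> p_prime; have [->|z_neq0] /= := eqVneq z 0.
  by rewrite expr0n subn_eq0 leqNgt prime_gt1.
apply: (mulfI z_neq0); rewrite -exprS subn1 prednK ?prime_gt0 // mulr1.
by have := expf_card z; rewrite card_Fp.
Qed.

Lemma intr_Fp_eqmod {p : nat} {m n : int} :
  prime p -> (m = n %[mod p%:Z])%Z -> m%:~R = n%:~R :> 'F_p.
Proof.
move=> p_prime /eqP; rewrite eqz_mod_dvd (dvdz_pcharf (pchar_Fp p_prime)).
by rewrite rmorphB subr_eq0 => /eqP.
Qed.

Lemma phi_fixed_point (p : nat) (c : int) (z : 'F_p) :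
  prime p ->
  ((map_poly intr (phi (p - 1) c)).[z] - z == 0)
    = if z == 0 then c%:~R == 0 :> 'F_p else z == 1 + c%:~R.
Proof.
move=> p_prime; rewrite /phi rmorphD /= map_polyXn map_polyC /=.
rewrite hornerD hornerXn hornerC Fp_fermat //.
by have [->|_] /= := eqVneq z 0; rewrite ?add0r ?subr0 // subr_eq0 eq_sym.
Qed.

(** The two summands record whether the candidates [0] and [1 + c] are fixed
    points.  They are never counted twice, because [1 + c] only qualifies when
    it is nonzero. *)
Lemma M_count (p : nat) (c : int) :
  prime p ->
  M p c = ((c%:~R == 0 :> 'F_p)%R + (c%:~R != -1 :> 'F_p)%R)%N.
Proof.
move=> p_prime; rewrite /M (cardsD1 0) inE phi_fixed_point // eqxx.
congr (_ + _)%N; rewrite -addr_eq0 addrC.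
have [c1_eq0|c1_neq0] /= := eqVneq (1 + c%:~R : 'F_p) 0.
  apply/eqP; rewrite cards_eq0; apply/eqP/setP => z.
  by rewrite !inE phi_fixed_point // c1_eq0; case: eqP.
apply: etrans (cards1 (1 + c%:~R : 'F_p)); apply: eq_card => z.
rewrite !inE phi_fixed_point //.
by have [->|//] := eqVneq z 0; rewrite [RHS]eq_sym (negPf c1_neq0).
Qed.

Theorem theorem3p2 (p : nat) (p_prime : prime p) (p_ge5 : (5 <= p)%N) (c : int) :
  [/\ (c = 1 %[mod p%:Z])%Z -> M p c = 1%N,
      forall t : int, c = p%:Z * t -> M p c = 2%N
    & (c = -1 %[mod p%:Z])%Z -> M p c = 0%N].
Proof.
have neg1_neq0 : -1 != 0 :> 'F_p by rewrite oppr_eq0 oner_eq0.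
split=> [c_eq1|t c_eq|c_eqN1]; rewrite M_count //.
- rewrite (intr_Fp_eqmod p_prime c_eq1) oner_eq0 -addr_eq0.
  (* [1 + 1] vanishes in characteristic [p] only if [p] divides [2]. *)
  have -> : (1%:~R + 1 : 'F_p) = 2%:R by [].
  by rewrite -(dvdn_pcharf (pchar_Fp p_prime)) gtnNdvd // (leq_trans _ p_ge5).
- have -> : c%:~R = 0 :> 'F_p.
    apply/eqP; rewrite -(dvdz_pcharf (pchar_Fp p_prime)) c_eq.
    exact: dvdz_mulr.
  by rewrite eqxx eq_sym neg1_neq0.
- by rewrite (intr_Fp_eqmod p_prime c_eqN1) rmorphN1 eqxx (negPf neg1_neq0).
Qed.
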